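(* Let $(\Omega,\Sigma,\mathbb P)$ and $(D,\Sigma',\rho)$ be probability spaces, let $d\in\mathbb N$, and let $\mathcal V$ be a subset of the power set of $[d]=\{1,\dots,d\}$. Assume that $Q_n$, given by $$Q_n(\omega,f)=\sum_{i=1}^nw_if(\boldsymbol x^{(i)}(\omega)),\qquad\omega\in\Omega^d,\ w_1,\dots,w_n\in\mathbb R,\ f\in L^2(D^d,\rho^d),$$ with random points $\boldsymbol x^{(i)}:\Omega^d\to D^d$, is a randomized linear algorithm satisfying the following condition: ( * ) For all $v\in\mathcal V$ the random points $\boldsymbol x^{(i)}_v=(x^{(i)}_j(\omega))_{j\in v}\in D^v$, $i=1,\dots,n$, are of the form $\boldsymbol x^{(i)}_v=(x^{(i)}_j(\omega_j))_{j\in v}$, and the random variables $x^{(i)}_j$ are distributed according to the law $\rho$. Then for each $f\in L^2(D^d,\rho^d)$ whose ANOVA terms $f_v$ vanish if $v\notin\mathcal V$ we have $$[Q_n(\cdot,f)]_u=Q_n(\cdot,f_u)\quad\text{for all }u\subseteq[d].$$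
   Context: ANOVA decomposition: for a probability space $(E,\mathcal E,\pi)$ and $g\in L^2(E^d,\pi^d)$, one has $g=\sum_{u\subseteq[d]}g_u$, where the ANOVA terms $g_u$ are defined recursively by $g_\emptyset=\int_{E^d}g\,d\pi^d$ and $$g_u(\boldsymbol x)=\int_{E^{[d]\setminus u}}g(\boldsymbol x_u,\boldsymbol y)\,\pi^{[d]\setminus u}(d\boldsymbol y)-\sum_{v\subsetneq u}g_v(\boldsymbol x),$$ $(\boldsymbol x_u,\boldsymbol y)$ being the vector with $j$th component $x_j$ for $j\in u$ and $y_j$ for $j\notin u$; $g_u$ depends only on $\boldsymbol x_u=(x_j)_{j\in u}$. $f_u$ denotes the ANOVA terms of $f\in L^2(D^d,\rho^d)$, and $[Q_n(\cdot,f)]_u$ the ANOVA terms of $\omega\mapsto Q_n(\omega,f)$ regarded as a function on $\Omega^d$ (with measure $\mathbb P^d$); for fixed $f$ this function is assumed to be square integrable. *)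

(* Defs.v *)
From HB Require Import structures.
From mathcomp Require Import all_boot all_order all_algebra.
From mathcomp Require Import all_classical all_reals all_analysis.

Set Implicit Arguments.
Unset Strict Implicit.
Unset Printing Implicit Defensive.

Import Order.TTheory GRing.Theory Num.Theory.
Import numFieldNormedType.Exports.

Local Open Scope classical_set_scope.
Local Open Scope ring_scope.

Definition tcons (T : Type) (n : nat) (z : T * n.-tuple T) : n.+1.-tuple T :=
  [the n.+1.-tuple T of z.1 :: z.2].

Lemma measurable_tcons d (T : measurableType d) (n : nat) :
  measurable_fun [set: T * n.-tuple T] (@tcons T n).
Proof.
exact: (@measurable_cons _ _ _ _ fst n snd measurable_fst measurable_snd).
Qed.

HB.instance Definition _ d (T : measurableType d) (n : nat) :=
  isMeasurableFun.Build _ _ (T * n.-tuple T)%type (n.+1.-tuple T)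
    (@tcons T n) (@measurable_tcons d T n).

(* The product measure on [n.-tuple T] with all factors equal to [P],
   obtained by iterating the binary product; see [power_box]. *)
Fixpoint power d (T : measurableType d) (R : realType) (P : probability T R)
    (n : nat) : probability (n.-tuple T) R :=
  match n with
  | 0 => dirac [tuple]
  | m.+1 => distribution (P \x power P m)%E (@tcons T m)
  end.

Lemma measurable_box d (T : measurableType d) (n : nat) (A : 'I_n -> set T) :
  (forall i, measurable (A i)) ->
  measurable [set t : n.-tuple T | forall i, A i (tnth t i)].
Proof.
move=> mA.
have -> : [set t : n.-tuple T | forall i, A i (tnth t i)] =
    \bigcap_(i in [set: 'I_n]) ((fun t => tnth t i) @^-1` A i).
  by apply/seteqP; split=> t /= h i; [move=> _; exact: h | exact: h].
apply: fin_bigcap_measurable => [|i _]; first exact: finite_finset.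
rewrite -[X in measurable X]setTI.
by apply: (@measurable_tnth _ T n i measurableT); exact: mA.
Qed.

Lemma power_box d (T : measurableType d) (R : realType) (P : probability T R)
    (n : nat) (A : 'I_n -> set T) :
  (forall i, measurable (A i)) ->
  power P n [set t | forall i, A i (tnth t i)] = (\prod_(i < n) P (A i))%E.
Proof.
elim: n A => [|n IH] A mA.
  rewrite big_ord0 /= /dirac/= indicE mem_set//=.
  by move=> [].
rewrite big_ord_recl -IH; last by move=> i; exact: mA.
rewrite -product_measure1E; [|exact: mA|]; last first.
  by apply: (@measurable_box _ T n (fun i => A (lift ord0 i))) => i; exact: mA.
congr ((P \x power P n)%E _).
apply/seteqP; split=> -[a t] /=.
  move=> h; split; first by have := h ord0; rewrite tnth0.
  by move=> i; have := h (lift ord0 i); rewrite tnthS.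
move=> [h0 h1] i; case: (unliftP ord0 i) => [j|] ->; rewrite ?tnthS ?tnth0//.
Qed.

Section anova.
Context d (E : measurableType d) (R : realType) (pi : probability E R).
Context (s : nat).
Implicit Types (u v : {set 'I_s}) (g : s.-tuple E -> R).

(* $E^{[s]\setminus u}$ is represented by tuples of length [#|~: u|], the
   coordinates being listed in increasing order. *)
Definition merge u (x : s.-tuple E) (y : #|~: u|.-tuple E) : s.-tuple E :=
  [tuple if j \in u then tnth x j
         else nth (tnth x j) y (index j (enum (~: u))) | j < s].

Lemma merge_in u x y j : j \in u -> tnth (@merge u x y) j = tnth x j.
Proof. by move=> ju; rewrite tnth_mktuple ju. Qed.

Lemma merge_notin u x y (k : 'I_#|~: u|) :
  tnth (@merge u x y) (enum_val k) = tnth y k.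
Proof.
have K (j0 : 'I_s) : index (enum_val k) (enum (~: u)) = k.
  by rewrite (enum_val_nth j0) index_uniq ?enum_uniq// -cardE.
have := enum_valP k; rewrite inE => /negbTE nu.
by rewrite tnth_mktuple nu (K (enum_val k)) -tnth_nth.
Qed.

(* The recursion on strict inclusion is run with [#|u|] as fuel;
   [anova_set0] and [anovaE] are the defining equations. *)
Fixpoint anova_rec g (k : nat) u (x : s.-tuple E) : R :=
  if u == finset.set0 then \int[power pi s]_z g z
  else match k with
  | 0 => 0
  | m.+1 => \int[power pi #|~: u|]_y g (merge x y)
            - \sum_(v : {set 'I_s} | v \proper u) anova_rec g m v x
  end.

Definition anova g u : s.-tuple E -> R := anova_rec g #|u| u.

Lemma anova_set0 g x : anova g finset.set0 x = \int[power pi s]_z g z.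
Proof. by rewrite /anova cards0 /= eqxx. Qed.

Lemma anova_rec_fuel g k u x :
  (#|u| <= k)%N -> anova_rec g k u x = anova_rec g #|u| u x.
Proof.
have [m] := ubnP #|u|; elim: m k u => // m IH k u um uk.
have [->|u0] := eqVneq u finset.set0.
  by rewrite cards0; case: k {uk} => /= [|k]; rewrite eqxx.
have : (0 < #|u|)%N by rewrite card_gt0.
case cu : #|u| => [//|c] _; rewrite cu in um uk.
case: k uk => // k ck /=; rewrite (negbTE u0); congr (_ - _).
apply: eq_bigr => v /proper_card; rewrite cu ltnS => vc.
rewrite [LHS]IH ?[RHS]IH ?(leq_trans vc)//.
- exact: leq_ltn_trans vc um.
- exact: leq_ltn_trans vc um.
Qed.

Lemma anovaE g u x : u != finset.set0 ->
  anova g u x = \int[power pi #|~: u|]_y g (merge x y)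
                - \sum_(v : {set 'I_s} | v \proper u) anova g v x.
Proof.
move=> u0; have : (0 < #|u|)%N by rewrite card_gt0.
rewrite {1}/anova; case cu : #|u| => [//|c] _ /=; rewrite (negbTE u0).
congr (_ - _); apply: eq_bigr => v /proper_card; rewrite cu ltnS => vc.
exact: anova_rec_fuel.
Qed.

End anova.

Section randomized_algorithm.
Context dO dD (Omega : measurableType dO) (D : measurableType dD).
Context (R : realType) (P : probability Omega R) (rho : probability D R).
Context (d n : nat).

Definition Qn (w : 'I_n -> R)
    (x : 'I_n -> {mfun d.-tuple Omega >-> d.-tuple D})
    (omega : d.-tuple Omega) (f : d.-tuple D -> R) : R :=
  \sum_(i < n) w i * f (x i omega).

Definition coordinatewise_rho (V : {set {set 'I_d}})
    (x : 'I_n -> {mfun d.-tuple Omega >-> d.-tuple D}) : Prop :=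
  forall v, v \in V -> forall (i : 'I_n) (j : 'I_d), j \in v ->
    exists xij : {RV P >-> D},
      (forall omega, tnth (x i omega) j = xij (tnth omega j)) /\
      (forall A, measurable A -> distribution P xij A = rho A).

(* [Qn w x] acts on almost-everywhere classes, as it must in order to be an
   operation on $L^2(\rho^d)$ when $L^2$ is read as a space of classes.  This is
   not automatic, since the law of a random point need not be absolutely
   continuous with respect to $\rho^d$ (e.g. when a coordinate is constant). *)
Definition compatible_ae (w : 'I_n -> R)
    (x : 'I_n -> {mfun d.-tuple Omega >-> d.-tuple D}) : Prop :=
  forall g h : d.-tuple D -> R,
    g \in Lfun (power rho d) 2%:E -> h \in Lfun (power rho d) 2%:E ->
    g = h %[ae power rho d] ->
    (Qn w x)^~ g = (Qn w x)^~ h %[ae power P d].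

End randomized_algorithm.

(* Main.v *)
(* The averaging operators [average u g x], the integral over z of
   g(x_u, z_{-u}), satisfy A_u A_v = A_{u \cap v} almost everywhere, and
   A_u g is the sum of the g_v over v \subset u.  Hence A_u g_v is g_v when
   v \subset u and vanishes almost everywhere otherwise.  If v is in V and h
   depends only on the coordinates in v, then A_u (h o x_i) = (A_u h) o x_i,
   because x_i acts coordinatewise and preserves the laws on those coordinates.
   Moreover Q f_v vanishes almost everywhere for v outside V.  Applied to
   f = \sum_v f_v this gives A_u (Q f) = \sum_{v \subset u} Q f_v almost
   everywhere, and the theorem follows by induction on u. *)
Require Import Defs.
From HB Require Import structures.
From mathcomp Require Import all_boot all_order all_algebra.
From mathcomp Require Import all_classical all_reals all_analysis.
From mathcomp Require Import measurable_realfun.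

Set Implicit Arguments.
Unset Strict Implicit.
Unset Printing Implicit Defensive.

Import Order.TTheory GRing.Theory Num.Theory.
Import numFieldNormedType.Exports.

Local Open Scope classical_set_scope.
Local Open Scope ring_scope.

(** * Random variables with a common law *)

Section same_law.
Context d1 d2 d3 (T1 : measurableType d1) (T2 : measurableType d2)
  (T : measurableType d3) (R : realType).
Variables (m1 : probability T1 R) (m2 : probability T2 R).
Implicit Types (X : T1 -> T) (Y : T2 -> T).

Definition same_law X Y : Prop :=
  [/\ measurable_fun [set: _] X, measurable_fun [set: _] Y &
      forall A, measurable A -> m1 (X @^-1` A) = m2 (Y @^-1` A)].

(** For nonnegative functions both sides are integrals against the common image measure; the general
    case splits [g] into positive and negative parts. *)
Lemma same_law_integral X Y (g : T -> \bar R) :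
  same_law X Y -> measurable_fun [set: _] g ->
  (\int[m1]_t g (X t) = \int[m2]_t g (Y t))%E.
Proof.
move=> [mX mY XY] mg.
have ge0 (h : T -> \bar R) :
    measurable_fun [set: _] h -> (forall t, 0 <= h t)%E ->
    (\int[m1]_t h (X t) = \int[m2]_t h (Y t))%E.
  move=> mh h0.
  have := @ge0_integral_pushforward _ _ _ _ _ X mX m1 setT h measurableT mh
    (fun t _ => h0 t).
  have := @ge0_integral_pushforward _ _ _ _ _ Y mY m2 setT h measurableT mh
    (fun t _ => h0 t).
  rewrite !preimage_setT => <- <-.
  by apply: eq_measure_integral => A mA _; exact: XY.
rewrite integralE [RHS]integralE; congr (_ - _)%E.
- rewrite (funepos_comp g X) (funepos_comp g Y).
  by apply: ge0 => //; exact: measurable_funepos.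
- rewrite (funeneg_comp g X) (funeneg_comp g Y).
  by apply: ge0 => //; exact: measurable_funeneg.
Qed.

Lemma same_law_integrable X Y (g : T -> \bar R) :
  same_law X Y -> measurable_fun [set: _] g ->
  m2.-integrable setT (g \o Y) -> m1.-integrable setT (g \o X).
Proof.
move=> XY mg /integrableP[_ gY]; apply/integrableP; split.
  by case: XY => mX _ _; exact: measurableT_comp.
by rewrite (same_law_integral XY (measurableT_comp _ mg)).
Qed.

End same_law.

(** * Laws on tuples are determined by boxes *)

Section same_law_tuple.
Context d1 d2 d3 (T1 : measurableType d1) (T2 : measurableType d2)
  (T : measurableType d3) (R : realType) (n : nat).
Variables (m1 : probability T1 R) (m2 : probability T2 R).

Let box : set (set (n.-tuple T)) :=
  [set B | exists2 A : 'I_n -> set T, (forall i, measurable (A i)) &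
    B = [set t | forall i, A i (tnth t i)]].

(** Boxes are closed under intersection and generate the product sigma-algebra, so finite measures
    agreeing on them coincide. *)
Lemma same_law_box (X : T1 -> n.-tuple T) (Y : T2 -> n.-tuple T) :
  measurable_fun [set: _] X -> measurable_fun [set: _] Y ->
  (forall A : 'I_n -> set T, (forall i, measurable (A i)) ->
     m1 [set t | forall i, A i (tnth (X t) i)] =
     m2 [set t | forall i, A i (tnth (Y t) i)]) ->
  same_law m1 m2 X Y.
Proof.
move=> mX mY XY; split=> // A mA.
pose X' : {mfun T1 >-> n.-tuple T} :=
  HB.pack X (isMeasurableFun.Build _ _ _ _ _ mX).
pose Y' : {mfun T2 >-> n.-tuple T} :=
  HB.pack Y (isMeasurableFun.Build _ _ _ _ _ mY).
have boxT : box setT.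
  by exists (fun=> setT) => //; apply/seteqP; split.
apply: (measure_unique box (fun=> setT) _ _ _ _ (distribution m1 X')
  (distribution m2 Y')) => //.
- apply/seteqP; split.
    apply: smallest_sub; first exact: smallest_sigma_algebra.
    rewrite -bigcup_seq; apply: bigcup_sub => i _ _ [B mB <-].
    (* A cylinder over coordinate [i] is a box with all other sides full. *)
    apply: sub_sigma_algebra; exists (fun j => if j == i then B else setT).
      by move=> j; case: ifP.
    apply/seteqP; split=> [t /= [_ Bt] j|t /= /(_ i)]; last by rewrite eqxx.
    by case: eqP => // ->.
  apply: smallest_sub; first exact: sigma_algebra_measurable.
  by move=> _ [B mB ->]; exact: measurable_box.
- move=> _ _ [B mB ->] [C mC ->]; exists (fun i => B i `&` C i).
    by move=> i; exact: measurableI.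
  by apply/seteqP; split=> [t [tB tC] i|t tBC]; [|split=> i; case: (tBC i)].
- exact: bigcup_const.
- by move=> _ [B mB ->]; exact: XY.
- move=> _; apply: le_lt_trans (ltry 1).
  exact: (@probability_le1 _ _ _ (distribution m1 X') _ measurableT).
Qed.

End same_law_tuple.

(** * Overwriting coordinates by an independent copy *)

Section mix.
Context d (E : measurableType d) (R : realType) (P : probability E R) (n : nat).
Implicit Types (u v : {set 'I_n}) (x y z : n.-tuple E).

Definition agree_on u x y := forall j, j \in u -> tnth x j = tnth y j.

Definition depends_on u (V : Type) (g : n.-tuple E -> V) :=
  forall x y, agree_on u x y -> g x = g y.

(** Unlike in [merge], [y] is a full tuple, so that averages over different [u] are all integrals
    over the same space; the surplus coordinates integrate out. *)
Definition mix u x y : n.-tuple E :=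
  [tuple if j \in u then tnth x j else tnth y j | j < n].

Lemma tnth_mix u x y j :
  tnth (mix u x y) j = if j \in u then tnth x j else tnth y j.
Proof. by rewrite tnth_mktuple. Qed.

Lemma mix0 x y : mix finset.set0 x y = y.
Proof. by apply: eq_from_tnth => j; rewrite tnth_mix inE. Qed.

(** The pointwise identity behind A_u A_v = A_{u \cap v}. *)
Lemma mix_mix u v x y z :
  mix v (mix u x y) z = mix (u :&: v) x (mix v y z).
Proof.
apply: eq_from_tnth => j; rewrite !tnth_mix inE.
by case: (j \in u); case: (j \in v).
Qed.

Lemma measurable_mix u :
  measurable_fun [set: _] (fun t : n.-tuple E * n.-tuple E => mix u t.1 t.2).
Proof.
apply/measurable_fun_tnthP => j.
have [ju|ju] := boolP (j \in u).
- rewrite (_ : _ \o _ = (fun t => tnth t j) \o fst).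
    by apply: measurableT_comp => //; exact: measurable_tnth.
  by apply/funext => t /=; rewrite tnth_mix ju.
- rewrite (_ : _ \o _ = (fun t => tnth t j) \o snd).
    by apply: measurableT_comp => //; exact: measurable_tnth.
  by apply/funext => t /=; rewrite tnth_mix (negbTE ju).
Qed.

Lemma measurable_mixr u x : measurable_fun [set: _] (mix u x).
Proof. exact: (measurable_fun_pair2 _ (measurable_mix u)). Qed.

(** On a box, the sides with index in [u] constrain only the first tuple and the others only the
    second, so the product measure factors. *)
Lemma same_law_mix u :
  same_law (power P n \x power P n)%E (power P n)
    (fun t => mix u t.1 t.2) id.
Proof.
apply: same_law_box => //; first exact: measurable_mix.
move=> A mA; rewrite power_box//.
pose B j := if j \in u then A j else setT.
pose C j := if j \in u then setT else A j.
have mB j : measurable (B j) by rewrite /B; case: ifP.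
have mC j : measurable (C j) by rewrite /C; case: ifP.
rewrite (_ : [set _ | _] = [set t | forall j, B j (tnth t j)] `*`
    [set t | forall j, C j (tnth t j)]).
  rewrite [LHS]product_measure1E; [|exact: measurable_box..].
  transitivity ((\prod_(j < n) P (B j)) * (\prod_(j < n) P (C j)))%E.
    by congr (_ * _)%E; exact: power_box.
  rewrite -big_split/=; apply: eq_bigr => j _; rewrite /B /C.
  by case: ifP => _; rewrite probability_setT ?mule1 ?mul1e.
apply/seteqP; split=> [[x y] /= xy|[x y] [/= Bx Cy] j].
  by split=> j /=; rewrite /B /C; have := xy j; rewrite tnth_mix; case: ifP.
by rewrite tnth_mix; have := Bx j; have := Cy j; rewrite /B /C; case: ifP.
Qed.

Lemma measurable_merge u x : measurable_fun [set: _] (@Defs.merge _ E n u x).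
Proof.
apply/measurable_fun_tnthP => j; have [ju|ju] := boolP (j \in u).
  rewrite (_ : _ \o _ = cst (tnth x j)); first exact: measurable_cst.
  by apply/funext => y /=; rewrite merge_in.
have ju' : j \in ~: u by rewrite inE.
rewrite (_ : _ \o _ = fun y : #|~: u|.-tuple E => tnth y (enum_rank_in ju' j)).
  exact: measurable_tnth.
by apply/funext => y /=; rewrite -(merge_notin x y) enum_rankK_in.
Qed.

Definition restrict_to u x : #|u|.-tuple E :=
  [tuple tnth x (enum_val k) | k < #|u|].

(** Marginals of a power are powers: this turns the integral over [#|~: u|]-tuples in the ANOVA
    recursion into one over full tuples. *)
Lemma same_law_restrict u :
  same_law (power P n) (power P #|u|) (restrict_to u) id.
Proof.
apply: same_law_box => //.
  apply/measurable_fun_tnthP => k.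
  rewrite (_ : _ \o _ = fun x => tnth x (enum_val k)).
    exact: measurable_tnth.
  by apply/funext => x /=; rewrite tnth_mktuple.
move=> A mA; rewrite power_box//.
(* [B] extends [A] by full sides outside [u]; [pselect] supplies the membership proof that
   [enum_rank_in] takes. *)
pose B j := if pselect (j \in u) is left ju then A (enum_rank_in ju j) else setT.
have mB j : measurable (B j) by rewrite /B; case: pselect.
have BE k : B (enum_val k) = A k.
  by rewrite /B; case: pselect => [h|/(_ (enum_valP k))//]; rewrite enum_valK_in.
rewrite (_ : [set _ | _] = [set t | forall j, B j (tnth t j)]).
  rewrite power_box// (bigID (mem u))/= [X in (_ * X)%E]big1 ?mule1.
    rewrite big_enum_val/=.
    by apply: eq_bigr => k _; rewrite BE.
  by move=> j ju; rewrite /B; case: pselect => [h|_];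
    [rewrite h in ju|rewrite probability_setT].
apply/seteqP; split=> [x /= Ax j|x /= Bx k].
  rewrite /B; case: pselect => // ju.
  by have := Ax (enum_rank_in ju j); rewrite tnth_mktuple enum_rankK_in.
by rewrite tnth_mktuple -BE.
Qed.

Lemma merge_restrict u x y : Defs.merge x (restrict_to (~: u) y) = mix u x y.
Proof.
apply: eq_from_tnth => j; rewrite tnth_mix; have [ju|ju] := boolP (j \in u).
  exact: merge_in.
have ju' : j \in ~: u by rewrite inE.
have [k ->] : exists k : 'I_#|~: u|, j = enum_val k.
  by exists (enum_rank_in ju' j); rewrite enum_rankK_in.
by rewrite merge_notin tnth_mktuple.
Qed.

End mix.

(** * Integrals of finite linear combinations *)

Section linear_combinations.
Context d (T : measurableType d) (R : realType).
Variable mu : {measure set T -> \bar R}.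

Lemma integrable_lincomb (I : Type) (r : seq I) (Q : pred I) (c : I -> R)
    (g : I -> T -> R) :
  (forall i, Q i -> mu.-integrable [set: T] (EFin \o g i)) ->
  mu.-integrable [set: T]
    (EFin \o (fun t => \sum_(i <- r | Q i) c i * g i t)).
Proof.
move=> ig; rewrite (_ : _ \o _ =
    fun t => (\sum_(i <- r | Q i) (c i)%:E * (g i t)%:E)%E).
  by apply: integrable_sum => // i Qi; apply: integrableZl => //; exact: ig.
by apply/funext => t /=; rewrite -sumEFin; apply: eq_bigr => i _; rewrite EFinM.
Qed.

Lemma Rintegral_lincomb (I : Type) (r : seq I) (Q : pred I) (c : I -> R)
    (g : I -> T -> R) :
  (forall i, Q i -> mu.-integrable [set: T] (EFin \o g i)) ->
  \int[mu]_t (\sum_(i <- r | Q i) c i * g i t) =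
  \sum_(i <- r | Q i) c i * \int[mu]_t g i t.
Proof.
move=> ig; elim: r => [|i r IH].
  rewrite big_nil; under eq_Rintegral do rewrite big_nil.
  by rewrite Rintegral_cst// mul0r.
rewrite big_cons; under eq_Rintegral do rewrite big_cons.
case: ifPn => // Qi; rewrite RintegralD//; last 2 first.
- rewrite (_ : _ \o _ = fun t => ((c i)%:E * (g i t)%:E)%E).
    by apply: integrableZl => //; exact: ig.
  by apply/funext => t /=; rewrite EFinM.
- exact: integrable_lincomb.
- by rewrite IH RintegralZl//; exact: ig.
Qed.

End linear_combinations.

(** * Averaging operators *)

Section average.
Context d (E : measurableType d) (R : realType) (P : probability E R) (n : nat).
Implicit Types (u v : {set 'I_n}) (x y z : n.-tuple E) (g h : n.-tuple E -> R).

Local Notation Pn := (power P n).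
Local Notation L1 g := (Pn.-integrable [set: _] (EFin \o g)).

(** For integrable [g] this is 0 at those [x] whose section is not integrable, which is why
    linearity and the composition rule are stated almost everywhere. *)
Definition average u g x : R := \int[Pn]_z g (mix u x z).

Lemma measurable_L1 g : L1 g -> measurable_fun [set: _] g.
Proof. by move=> /measurable_int/measurable_EFinP. Qed.

Lemma integrable_mix u g : L1 g ->
  (Pn \x Pn)%E.-integrable [set: _] (fun t => (g (mix u t.1 t.2))%:E).
Proof.
move=> ig.
exact: (same_law_integrable (same_law_mix P u) (measurable_int _ ig) ig).
Qed.

Lemma ae_integrable_section u g : L1 g ->
  {ae Pn, forall x, L1 (fun z => g (mix u x z))}.
Proof. by move=> ig; exact: (ae_integrable1 (integrable_mix u ig)). Qed.

Lemma integrable_average u g : L1 g -> L1 (average u g).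
Proof.
move=> ig; have igm := integrable_mix u ig.
apply: (le_integrable measurableT _ _ (integrable_fubini_F igm)).
  apply/measurable_EFinP; apply: measurableT_comp (measurable_fubini_F igm).
  exact: fine_measurable.
(* [fine] sends an infinite inner integral to 0, which only lowers the absolute value. *)
move=> x _ /=; rewrite /average /Rintegral /fubini_F.
by case: (\int[Pn]_z (g (mix u x z))%:E)%E => [r||] //=; rewrite normr0 leey.
Qed.

Lemma average_lincomb (I : finType) (Q : pred I) (c : I -> R)
    (g : I -> n.-tuple E -> R) u :
  (forall i, Q i -> L1 (g i)) ->
  average u (fun x => \sum_(i | Q i) c i * g i x) =
  (fun x => \sum_(i | Q i) c i * average u (g i) x) %[ae Pn].
Proof.
move=> ig.
have : {ae Pn, forall x, forall i, Q i -> L1 (fun z => g i (mix u x z))}.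
  (* The index type is finite, so the quantifier over [i] may be moved inside the almost everywhere
     one. *)
  apply: filter_forall => i.
  have [Qi|nQi] := boolP (Q i); last exact: aeW.
  by apply: filterS (ae_integrable_section u (ig i Qi)).
by apply: filterS => x ix _; exact: Rintegral_lincomb.
Qed.

(** By Tonelli and [same_law_mix], the iterated integral of |g(mix u x z)| equals that of |g|, which
    is 0; hence the inner integral vanishes for almost every [x]. *)
Lemma average_ae0 u g : L1 g -> g = cst 0 %[ae Pn] ->
  average u g = cst 0 %[ae Pn].
Proof.
move=> ig g0; have mg := measurable_int _ ig.
have mag : measurable_fun [set: _] (fun x => `|(g x)%:E|%E).
  exact: measurableT_comp.
have gm0 : (\int[Pn]_x `| \int[Pn]_z `|(g (mix u x z))%:E| | = 0)%E.
  under eq_integral do rewrite gee0_abs ?integral_ge0//.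
  rewrite -(fubini_tonelli1 (fun t => `|(g (mix u t.1 t.2))%:E|%E))//=; last first.
    by case: (same_law_mix P u) => mm _ _; exact: (measurableT_comp mag mm).
  rewrite (same_law_integral (same_law_mix P u) mag).
  apply/ae_eq_integral_abs => //; apply: filterS g0 => x /= /[apply] ->//.
have := (ae_eq_integral_abs Pn measurableT _).1 gm0.
case/integrableP: (integrable_mix u ig) => mgm _.
have mgm' : measurable_fun [set: _] (fun t => `|(g (mix u t.1 t.2))%:E|%E).
  exact: measurableT_comp.
move=> /(_ (measurable_fun_fubini_tonelli_F _ mgm' (fun _ => abse_ge0 _))).
apply: filterS => x /= /(_ I) gx0 _.
rewrite /average /Rintegral.
have mgx : measurable_fun [set: _] (fun z => (g (mix u x z))%:E).
  exact: (measurableT_comp mg (measurable_mixr u x)).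
have := le_abse_integral Pn measurableT mgx.
rewrite gx0 => h; suff -> : (\int[Pn]_z (g (mix u x z))%:E = 0)%E by [].
by apply/eqP; rewrite -abse_eq0 eq_le h abse_ge0.
Qed.

Lemma average_ae_eq u g h : L1 g -> L1 h -> g = h %[ae Pn] ->
  average u g = average u h %[ae Pn].
Proof.
move=> ig ih gh.
have igh : L1 (fun x => g x - h x).
  rewrite (_ : _ \o _ = (EFin \o g) \- (EFin \o h))%E.
    exact: integrableB.
  by apply/funext => x /=; rewrite EFinB.
have gh0 : (fun x => g x - h x) = cst 0 %[ae Pn].
  by apply: filterS gh => x /= /[apply] ->; rewrite subrr.
have := average_ae0 u igh gh0.
have := ae_integrable_section u ig; have := ae_integrable_section u ih.
apply: filterS3 => x ihx igx /= h0 xT; have := h0 xT.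
by rewrite {1}/average RintegralB// => /eqP; rewrite subr_eq0 => /eqP.
Qed.

Lemma depends_on_average u v g : depends_on v g ->
  depends_on (u :&: v) (average u g).
Proof.
move=> gv x y xy; apply: eq_Rintegral => z _; apply: gv => j jv.
by rewrite !tnth_mix; case: ifP => // ju; apply: xy; rewrite inE ju.
Qed.

Lemma average_depends_on u v g : depends_on v g -> v \subset u ->
  average u g = g.
Proof.
move=> gv vu; apply/funext => x; rewrite /average.
rewrite (_ : (fun z => g (mix u x z)) = cst (g x)).
  rewrite Rintegral_cst// [X in fine X](_ : _ = 1%E) ?mulr1//.
  exact: probability_setT.
apply/funext => z; apply: gv => j /(fintype.subsetP vu) ju.
by rewrite tnth_mix ju.
Qed.

(** With [G] the section of [g] at [x] over [u :&: v], [mix_mix] makes the left side a double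
    integral of G(mix v z t), which Fubini and [same_law_mix] reduce to the integral of [G]. *)
Lemma average_average u v g : L1 g ->
  average u (average v g) = average (u :&: v) g %[ae Pn].
Proof.
move=> ig; apply: filterS (ae_integrable_section (u :&: v) ig) => x ix _.
set G := fun z => g (mix (u :&: v) x z) in ix.
have mG := measurable_int _ ix.
transitivity (\int[Pn]_z (average v G z)).
  apply: eq_Rintegral => z _; apply: eq_Rintegral => t _.
  by rewrite /G mix_mix.
have iGm := integrable_mix v ix.
(* The inner [fine] can be removed for almost every [z], where the section of [G] is integrable. *)
transitivity (fine (\int[Pn]_x fubini_F Pn (fun t => (G (mix v t.1 t.2))%:E) x)%E).
  congr fine; apply: ae_eq_integral => //.
  - exact: measurable_int (integrable_average v ix).
  - exact: (measurable_fubini_F iGm).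
  - apply: filterS (ae_integrable_section v ix) => z iz _.
    by rewrite /= fineK//; exact: integrable_fin_num.
rewrite integral12_prod_meas1//.
by congr fine; exact: (same_law_integral (same_law_mix P v) mG).
Qed.

End average.

(** * ANOVA terms in terms of averages *)

Section anova_properties.
Context d (E : measurableType d) (R : realType) (P : probability E R) (n : nat).
Implicit Types (u v : {set 'I_n}) (x y z : n.-tuple E) (g h : n.-tuple E -> R).

Local Notation Pn := (power P n).
Local Notation L1 g := (Pn.-integrable [set: _] (EFin \o g)).

(** A single formula that also covers the empty set, where the sum is empty. *)
Lemma anova_averageE g u x : measurable_fun [set: _] g ->
  anova P g u x =
  average P u g x - \sum_(v : {set 'I_n} | v \proper u) anova P g v x.
Proof.
move=> mg; have [->|u0] := eqVneq u finset.set0.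
  rewrite anova_set0 big1 ?subr0.
    by apply: eq_Rintegral => z _; rewrite mix0.
  move=> v; rewrite fintype.properE finset.subset0 => /andP[/eqP ->].
  by rewrite finset.sub0set.
rewrite anovaE//; congr (_ - _); congr fine.
have mh : measurable_fun [set: #|~: u|.-tuple E]
    (fun t => (g (Defs.merge x t))%:E).
  apply/measurable_EFinP.
  exact: (measurableT_comp mg (measurable_merge x)).
rewrite -(same_law_integral (same_law_restrict P (~: u)) mh).
by apply: eq_integral => z _; rewrite merge_restrict.
Qed.

Lemma sum_anova_subset g u x : measurable_fun [set: _] g ->
  \sum_(v : {set 'I_n} | v \subset u) anova P g v x = average P u g x.
Proof.
move=> mg; rewrite (bigD1 u)//= anova_averageE//.
rewrite [X in _ - X](eq_bigl (fun v : {set 'I_n} =>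
    (v \subset u) && (v != u))) ?subrK//.
by move=> v; rewrite finset.properEneq andbC.
Qed.

Lemma sum_anova g x : measurable_fun [set: _] g ->
  \sum_(v : {set 'I_n}) anova P g v x = g x.
Proof.
move=> mg; rewrite (eq_bigl (fun v : {set 'I_n} => v \subset finset.setT)).
  rewrite sum_anova_subset// (@average_depends_on _ _ _ _ _ _ finset.setT)//.
  by move=> y z yz; congr g; apply: eq_from_tnth => j; apply: yz; rewrite inE.
by move=> v; rewrite finset.subsetT.
Qed.

(** Induction along strict inclusion, stated for a predicate on functions so that it serves
    pointwise, integrability and almost everywhere claims alike. *)
Lemma anova_ind (C : {set 'I_n} -> (n.-tuple E -> R) -> Prop) g :
  measurable_fun [set: _] g ->
  (forall u, (forall v, v \proper u -> C v (anova P g v)) ->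
     C u (fun x => average P u g x -
       \sum_(v : {set 'I_n} | v \proper u) anova P g v x)) ->
  forall u, C u (anova P g u).
Proof.
move=> mg CI u; have [m] := ubnP #|u|; elim: m u => // m IH u um.
rewrite (_ : anova P g u = fun x => average P u g x -
    \sum_(v : {set 'I_n} | v \proper u) anova P g v x).
  apply: CI => v vu; apply: IH.
  by apply: leq_trans (proper_card vu) _.
by apply/funext => x; exact: anova_averageE.
Qed.

Lemma depends_on_anova g u : measurable_fun [set: _] g ->
  depends_on u (anova P g u).
Proof.
move=> mg; apply: (@anova_ind (fun u h => depends_on u h)) => // {}u IH.
move=> x y xy; congr (_ - _).
  apply: eq_Rintegral => z _; congr g; apply: eq_from_tnth => j.
  by rewrite !tnth_mix; case: ifP => // ju; exact: xy.
apply: eq_bigr => v vu; apply: IH => // j jv; apply: xy.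
by case/fintype.properP: vu => /fintype.subsetP + _; exact.
Qed.

Lemma integrable_anova g u : L1 g -> L1 (anova P g u).
Proof.
move=> ig; apply: (@anova_ind (fun u h => L1 h)) => [|{}u IH].
  exact: measurable_L1 ig.
rewrite (_ : _ \o _ = (EFin \o average P u g) \-
    (EFin \o (fun x =>
      (\sum_(v : {set 'I_n} | v \proper u) 1 * anova P g v x)%R)))%E.
  apply: integrableB => //; first exact: integrable_average.
  exact: integrable_lincomb.
apply/funext => x /=; rewrite -EFinB; congr (_ - _)%:E.
by apply: eq_bigr => v _; rewrite mul1r.
Qed.

(** Apply A_u to g_v = A_v g - \sum_{w < v} g_w. The first term becomes A_{u \cap v} g; in the sum,
    A_u fixes the terms with [w] inside [u] and, by induction on the size, kills the others. The
    surviving [w] are exactly the subsets of u \cap v, since [v] itself is not inside [u], and their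
    g_w add up to A_{u \cap v} g. *)
Lemma average_anova_ae0 g u v : L1 g -> ~~ (v \subset u) ->
  average P u (anova P g v) = cst 0 %[ae Pn].
Proof.
move=> ig; have mg := measurable_L1 ig.
have [m] := ubnP #|v|; elim: m v => // m IH v vm vu.
(* [c] and [h] write g_v as one linear combination over the subsets of [v], the index [v] itself
   carrying A_v g. *)
pose c w : R := if w == v then 1 else -1.
pose h w := if w == v then average P v g else anova P g w.
have ih w : L1 (h w).
  by rewrite /h; case: ifP => _; [exact: integrable_average|exact: integrable_anova].
have -> : anova P g v =
    fun x => \sum_(w : {set 'I_n} | w \subset v) c w * h w x.
  apply/funext => x; rewrite anova_averageE// [RHS](bigD1 v)//= /c /h eqxx mul1r.
  rewrite -sumrN; congr (_ + _).
  apply: eq_big => [w|w]; first by rewrite finset.properEneq andbC.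
  by rewrite finset.properEneq => /andP[/negbTE -> _]; rewrite mulN1r.
have pw : {ae Pn, forall x, forall w : {set 'I_n},
    w \proper v -> ~~ (w \subset u) ->
    average P u (anova P g w) x = 0}.
  apply: filter_forall => w.
  have [wv|] := boolP (w \proper v); last by move=> _; exact: aeW.
  have [|wu] := boolP (w \subset u); first by move=> _; exact: aeW.
  have wm : (#|w| < m)%N by exact: leq_trans (proper_card wv) _.
  by apply: filterS (IH w wm wu) => x /(_ I).
have := average_lincomb (Q := fun w : {set 'I_n} => w \subset v) c u
  (fun w _ => ih w).
have := average_average u v ig.
apply: filterS3 pw => x pw /(_ I) uvx /(_ I) -> _.
rewrite (bigD1 v)//= {1}/c {1}/h eqxx mul1r uvx -sum_anova_subset//.
rewrite [X in _ + X](eq_bigr (fun w : {set 'I_n} =>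
    - (if w \subset u then anova P g w x else 0))); last first.
  move=> w /andP[wv wNv]; rewrite /c /h (negbTE wNv) mulN1r; congr (- _).
  case: ifPn => [wu|wu]; last by rewrite pw// finset.properEneq wNv.
  by rewrite (average_depends_on P (depends_on_anova mg)).
rewrite sumrN -big_mkcondr/=; apply/eqP; rewrite subr_eq0; apply/eqP.
apply: eq_bigl => w; rewrite finset.subsetI andbC.
have [wu|wu] := boolP (w \subset u); last by rewrite !andbF.
rewrite !andbT; case: (w \subset v) => //=.
by apply/esym; apply: contra vu => /eqP <-.
Qed.

End anova_properties.

(** * Composition with a random point *)

Section random_point.
Context dO dD (Omega : measurableType dO) (D : measurableType dD) (R : realType).
Context (P : probability Omega R) (rho : probability D R) (n : nat).
Variables (v : {set 'I_n}) (X : n.-tuple Omega -> n.-tuple D).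

Local Notation Pn := (power P n).
Local Notation rhon := (power rho n).

Hypothesis mX : measurable_fun [set: n.-tuple Omega] X.
Hypothesis hX : forall j, j \in v -> exists xj : {RV P >-> D},
  (forall omega, tnth (X omega) j = xj (tnth omega j)) /\
  (forall A, measurable A -> distribution P xj A = rho A).

(* The points are compared after overwriting the coordinates outside v by those
   of p, since nothing is known about the coordinates of X outside v. *)
Lemma same_law_point (p : n.-tuple D) :
  same_law Pn rhon (fun omega => mix v (X omega) p) (fun t => mix v t p).
Proof.
have mmix : measurable_fun [set: n.-tuple D] (fun t => mix v t p).
  exact: (measurable_fun_pair1 _ (measurable_mix v)).
apply: same_law_box => //; first exact: (measurableT_comp mmix mX).
move=> A mA.
pose hQ j (xj : {RV P >-> D}) := j \in v ->
  (forall omega, tnth (X omega) j = xj (tnth omega j)) /\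
  (forall B, measurable B -> distribution P xj B = rho B).
(* [choice] requires a value at every index; outside [v] the constant map is a placeholder, since
   [hQ] is vacuous there. *)
have [xj xjX] : {xj & forall j, hQ j (xj j)}.
  apply: choice => j.
  have [/hX[xj xjX]|jv] := boolP (j \in v); first by exists xj.
  by exists (cst point); rewrite /hQ (negbTE jv).
(* Outside [v] the coordinate is the fixed one of [p], so the corresponding side is either full or
   empty, on both spaces. *)
pose B j := if j \in v then xj j @^-1` A j else [set _ | A j (tnth p j)].
pose C j := if j \in v then A j else [set _ | A j (tnth p j)].
have mset d (T : measurableType d) (Q : Prop) : measurable [set _ : T | Q].
  have [q|nq] := pselect Q.
    by rewrite (_ : [set _ | _] = setT)//; apply/seteqP; split.
  by rewrite (_ : [set _ | _] = set0)//; apply/seteqP; split.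
have mB j : measurable (B j).
  rewrite /B; case: ifP => _; last exact: mset.
  by rewrite -[X in measurable X]setTI; exact: (measurable_funP (xj j)).
have mC j : measurable (C j) by rewrite /C; case: ifP => _; [exact: mA|exact: mset].
rewrite (_ : [set _ | _] = [set t | forall j, B j (tnth t j)]); last first.
  apply/seteqP; split=> t /= h j; have := h j; rewrite /B tnth_mix;
    by case: ifP => // jv; rewrite (xjX j jv).1.
rewrite (_ : [set t | forall j, A j _] = [set t | forall j, C j (tnth t j)]);
    last first.
  by apply/seteqP; split=> t /= h j; have := h j; rewrite /C tnth_mix; case: ifP.
rewrite !power_box//; apply: eq_bigr => j _; rewrite /B /C.
case: ifP => jv; first exact: (xjX j jv).2.
have [q|nq] := pselect (A j (tnth p j)).
  rewrite (_ : [set _ : Omega | _] = setT); last by apply/seteqP; split.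
  rewrite (_ : [set _ : D | _] = setT); last by apply/seteqP; split.
  by rewrite !probability_setT.
rewrite (_ : [set _ : Omega | _] = set0); last by apply/seteqP; split.
rewrite (_ : [set _ : D | _] = set0); last by apply/seteqP; split.
by rewrite !measure0.
Qed.

Let p : n.-tuple D := [tuple point | i < n].

Let agree_fill x : agree_on v x (mix v x p).
Proof. by move=> j jv; rewrite tnth_mix jv. Qed.

(** As [g] ignores the coordinates outside [v], they may be filled in by [p], after which
    [same_law_point] applies. *)
Lemma integral_point (g : n.-tuple D -> \bar R) :
  measurable_fun [set: n.-tuple D] g -> depends_on v g ->
  (\int[Pn]_omega g (X omega) = \int[rhon]_t g t)%E.
Proof.
move=> mg gv.
under eq_integral do rewrite (gv _ _ (agree_fill _)).
rewrite (same_law_integral (same_law_point p) mg).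
by apply: eq_integral => t _; rewrite -(gv _ _ (agree_fill _)).
Qed.

Lemma integrable_point (g : n.-tuple D -> R) : depends_on v g ->
  rhon.-integrable [set: _] (EFin \o g) ->
  Pn.-integrable [set: _] (EFin \o (g \o X)).
Proof.
move=> gv /integrableP[mg gfin]; apply/integrableP; split.
  exact: (measurableT_comp mg mX).
rewrite (@integral_point (fun t => `|(g t)%:E|%E))//.
  exact: measurableT_comp.
by move=> x y xy; rewrite (gv _ _ xy).
Qed.

(** A null set need not have a null preimage under [X]; for functions of the coordinates in [v],
    vanishing is transferred through the integral of |g|. *)
Lemma ae0_point (g : n.-tuple D -> R) : depends_on v g ->
  measurable_fun [set: n.-tuple D] g ->
  g = cst 0 %[ae rhon] -> g \o X = cst 0 %[ae Pn].
Proof.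
move=> gv mg g0.
have mEg : measurable_fun [set: n.-tuple D] (EFin \o g) by exact/measurable_EFinP.
have : (\int[Pn]_omega `|(EFin \o (g \o X)) omega| = 0)%E.
  rewrite (@integral_point (fun t => `|(g t)%:E|%E)).
  - by apply/ae_eq_integral_abs => //; apply: filterS g0 => t /= /[apply] ->.
  - exact: measurableT_comp.
  - by move=> x y xy; rewrite (gv _ _ xy).
move/ae_eq_integral_abs => /(_ measurableT (measurableT_comp mEg mX)).
by apply: filterS => omega /= /[apply] -[].
Qed.

(** On the coordinates in [v], [X] commutes with [mix u] because it acts coordinatewise;
    [integral_point] is then applied to the section [G] at each fixed [omega], so equality holds
    everywhere. *)
Lemma average_point (u : {set 'I_n}) (g : n.-tuple D -> R) : depends_on v g ->
  measurable_fun [set: n.-tuple D] g ->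
  average P u (g \o X) = average rho u g \o X.
Proof.
move=> gv mg; apply/funext => omega /=; congr fine.
pose G t := (g (mix u (X omega) t))%:E.
have mG : measurable_fun [set: n.-tuple D] G.
  by apply/measurable_EFinP; exact: (measurableT_comp mg (measurable_mixr _ _)).
have Gv : depends_on v G.
  move=> s t st; congr (_%:E); apply: gv => j jv; rewrite !tnth_mix.
  by case: ifP => // _; exact: st.
rewrite -(integral_point mG Gv); apply: eq_integral => omega' _ /=.
congr (_%:E); apply: gv => j jv; rewrite tnth_mix.
have [xj [xjE _]] := hX jv; rewrite !xjE tnth_mix.
by case: ifP.
Qed.

End random_point.

(** Places an almost everywhere vanishing f_v in L^2, as [compatible_ae] demands. *)
Lemma Lfun_ae_eq d (T : measurableType d) (R : realType)
    (mu : {measure set T -> \bar R}) (r : R) (g h : T -> R) :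
  measurable_fun [set: T] h -> g = h %[ae mu] ->
  g \in Lfun mu r%:E -> h \in Lfun mu r%:E.
Proof.
move=> mh gh /andP[]; rewrite !inE/= => mg gfin.
apply/andP; split; rewrite inE//=; move: gfin; congr (_ < _)%E.
rewrite unlock /Lnorm; congr (poweR _ _); apply: ae_eq_integral => //.
- apply: (measurableT_comp (measurable_poweR _)); apply: measurableT_comp => //.
  exact/measurable_EFinP.
- apply: (measurableT_comp (measurable_poweR _)); apply: measurableT_comp => //.
  exact/measurable_EFinP.
- by apply: filterS gh => t /= /[apply] ->.
Qed.

(** * ANOVA terms of the randomized algorithm *)

Theorem lemma2p1 (R : realType)
    (dO dD : measure_display)
    (Omega : measurableType dO) (P : probability Omega R)
    (D : measurableType dD) (rho : probability D R)
    (d n : nat) (V : {set {set 'I_d}})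
    (w : 'I_n -> R) (x : 'I_n -> {mfun d.-tuple Omega >-> d.-tuple D})
    (hx : coordinatewise_rho P rho V x)
    (f : d.-tuple D -> R)
    (hf : f \in Lfun (power rho d) 2%:E)
    (hQf : (Qn w x)^~ f \in Lfun (power P d) 2%:E)
    (hV : (forall v, v \notin V -> forall z, anova rho f v z = 0) \/
          (compatible_ae P rho w x /\
           forall v, v \notin V -> anova rho f v = cst 0 %[ae power rho d])) :
  forall u : {set 'I_d},
    anova P ((Qn w x)^~ f) u = (Qn w x)^~ (anova rho f u) %[ae power P d].
Proof.
have L21 d1 (T : measurableType d1) (Q : probability T R) (g : T -> R) :
    g \in Lfun Q 2%:E -> Q.-integrable [set: T] (EFin \o g).
  move=> g2; apply/Lfun1_integrable; apply: Lfun_subset12 g2.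
  exact: fin_num_measure.
have if_ := L21 _ _ _ _ hf; have iQf := L21 _ _ _ _ hQf.
have mf := measurable_L1 if_; have mQf := measurable_L1 iQf.
have mfv v : measurable_fun [set: _] (anova rho f v).
  exact: measurable_L1 (integrable_anova v if_).
pose Qv (v : {set 'I_d}) omega := Qn w x omega (anova rho f v).
have QvE v : Qv v = fun omega => \sum_(i < n) w i * (anova rho f v \o x i) omega.
  by [].
have Qv0 v : v \notin V -> Qv v = cst 0 %[ae power P d].
  (* Outside V the laws of the points are not controlled: either f_v is zero at every point, or
     [compatible_ae] carries its almost everywhere vanishing over to [Qv v]. *)
  move=> vV; case: hV => [hV0|[comp hV0]].
    apply: aeW => omega _; rewrite QvE /= big1// => i _.
    by rewrite hV0 ?mulr0.
  have Lfun0 : cst 0 \in Lfun (power rho d) 2%:E := Lfun_cst _ _ _.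
  have Lfunv : anova rho f v \in Lfun (power rho d) 2%:E.
    apply: Lfun_ae_eq Lfun0 => //.
    by apply: filterS (hV0 v vV) => z /[apply] ->.
  apply: filterS (comp _ _ Lfunv Lfun0 (hV0 v vV)) => omega /= + _.
  move=> /(_ I) Qv0; rewrite /Qv Qv0.
  by rewrite /Qn big1// => i _; rewrite mulr0.
have pointP v i : v \in V -> forall j, j \in v -> exists xj : {RV P >-> D},
  (forall omega, tnth (x i omega) j = xj (tnth omega j)) /\
  (forall A, measurable A -> distribution P xj A = rho A).
  by move=> vV j jv; exact: hx vV i j jv.
have mx i : measurable_fun [set: _] (x i) := measurable_funP (x i).
have depv v : depends_on v (anova rho f v) := depends_on_anova rho mf.
have ipoint v i : v \in V ->
    (power P d).-integrable [set: _] (EFin \o (anova rho f v \o x i)).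
  move=> vV; apply: (integrable_point (mx i) (pointP v i vV) (depv v)).
  exact: integrable_anova.
have iQv v : v \in V -> (power P d).-integrable [set: _] (EFin \o Qv v).
  by move=> vV; apply: integrable_lincomb => i _; exact: ipoint.
have averageQv u v : v \in V ->
    average P u (Qv v) = (if v \subset u then Qv v else cst 0) %[ae power P d].
  move=> vV; have := average_lincomb (Q := xpredT) w u (fun i _ => ipoint v i vV).
  have pw : {ae power P d, forall omega, forall i,
      average P u (anova rho f v \o x i) omega =
      if v \subset u then anova rho f v (x i omega) else 0}.
    apply: filter_forall => i.
    rewrite (average_point (mx i) (pointP v i vV) u (depv v) (mfv v)).
    have [vu|vu] := boolP (v \subset u).
      by rewrite (average_depends_on rho (depv v) vu); exact: aeW.
    (* A_u f_v vanishes only almost everywhere for [rho]; it still depends on the coordinates in [v]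
       alone, so [ae0_point] pulls this back along the random point. *)
    have dv : depends_on v (average rho u (anova rho f v)).
      move=> s t st; apply: (depends_on_average rho (u := u) (depv v)) => j.
      by rewrite inE => /andP[_]; exact: st.
    have ia := integrable_average u (integrable_anova v if_).
    have := ae0_point (mx i) (pointP v i vV) dv (measurable_L1 ia)
      (average_anova_ae0 if_ vu).
    by apply: filterS => omega /(_ I).
  apply: filterS2 pw => omega pw /(_ I) /= aE _; rewrite [LHS]aE.
  rewrite (eq_bigr _ (fun i _ => congr1 _ (pw i))).
  by case: ifP => // _; rewrite /= big1// => i _; rewrite mulr0.
(* The sum is cut down to V, where [iQv] gives integrability, and the factor 1 fits the form of
   [average_lincomb]. *)
have Qf_sum : (Qn w x)^~ f = (fun omega => \sum_(v in V) 1 * Qv v omega)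
    %[ae power P d].
  have : {ae power P d, forall omega, forall v, v \notin V -> Qv v omega = 0}.
    apply: filter_forall => v.
    have [vV|vV] := boolP (v \in V); first exact: aeW.
    by apply: filterS (Qv0 v vV) => omega /(_ I).
  apply: filterS => omega Q0 _.
  transitivity (\sum_v Qv v omega).
    rewrite /Qv /Qn exchange_big/=; apply: eq_bigr => i _.
    by rewrite -mulr_sumr sum_anova.
  rewrite (bigID (mem V))/= [X in _ + X]big1 ?addr0//.
  by apply: eq_bigr => v _; rewrite mul1r.
have averageQf u : average P u ((Qn w x)^~ f) =
    (fun omega => \sum_(v : {set 'I_d} | v \subset u) Qv v omega) %[ae power P d].
  have isum : (power P d).-integrable [set: _]
      (EFin \o (fun omega => \sum_(v in V) 1 * Qv v omega)).
    exact: integrable_lincomb.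
  have aw : {ae power P d, forall omega, forall v,
      if v \in V then average P u (Qv v) omega =
        (if v \subset u then Qv v omega else 0) else Qv v omega = 0}.
    apply: filter_forall => v; have [vV|vV] := boolP (v \in V).
      by apply: filterS (averageQv u v vV) => omega /(_ I) ->; case: ifP.
    by apply: filterS (Qv0 v vV) => omega /(_ I).
  have := average_lincomb (Q := mem V) (fun=> 1) u iQv.
  have := average_ae_eq u iQf isum Qf_sum.
  apply: filterS3 aw => omega aw /(_ I) -> /(_ I) -> _ /=.
  (* Extended by zero to all [v], the two sums agree term by term: outside V the value [Qv v omega]
     is 0. *)
  rewrite [RHS]big_mkcond [LHS]big_mkcond/=; apply: eq_bigr => v _.
  by have := aw v; case: ifP => _ => [->|->]; rewrite ?mul1r ?if_same.
(* By [averageQf] and the induction hypothesis, subtracting the terms of proper subsets leaves only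
   [Qv u]. *)
apply: (@anova_ind _ _ _ _ _ (fun u h => h = Qv u %[ae power P d])) => // u IH.
have pw : {ae power P d, forall omega, forall v : {set 'I_d}, v \proper u ->
    anova P ((Qn w x)^~ f) v omega = Qv v omega}.
  apply: filter_forall => v.
  have [vu|_] := boolP (v \proper u); last exact: aeW.
  by apply: filterS (IH v vu) => omega /(_ I).
apply: filterS2 pw (averageQf u) => omega pw /(_ I) -> _.
rewrite (bigD1 u)//= (eq_bigr _ pw).
rewrite [X in _ - X](eq_bigl (fun v : {set 'I_d} =>
    (v \subset u) && (v != u))) ?addrK//.
by move=> v; rewrite finset.properEneq andbC.
Qed.
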